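(* Let $n\ge 2$ be an integer and let $0,n-1\in A\subset\{0,1,\dots,n-1\}$. Let $C_A$ be the attractor of the iterated function system $\{x\mapsto (x+a)/n : a\in A\}$. Then one of the following is true. (1) $C_A+C_A=[0,2]$. (2) $C_A+C_A$ is a Cantor set, i.e. every point of $C_A+C_A$ is a boundary point of $C_A+C_A$ and $C_A+C_A$ has no isolated points. (3) $C_A+C_A$ contains a countably infinite number of maximal intervals and a countably infinite number of maximal gaps. Furthermore, the set of points in $C_A+C_A$ (in the sense defined in the context) has positive Hausdorff dimension.
   Context: The sign $+$ between sets denotes the Minkowski sum; explicitly $C_A=\left\{\sum_{i=1}^\infty a_i n^{-i} : a_i\in A\right\}$. A (nondegenerate) closed interval $I=[a,b]$, $a<b$, is an interval in $C_A+C_A$ if $I\subset C_A+C_A$; it is a maximal interval if it is not a proper subset of any other interval in $C_A+C_A$. An open interval $G=(a,b)$, $a<b$, is a gap in $C_A+C_A$ if $G\cap(C_A+C_A)=\varnothing$; it is a maximal gap if it is not a proper subset of any other gap in $C_A+C_A$. An element $g\in C_A+C_A$ is called a point in $C_A+C_A$ if, for every $\epsilon>0$, both $(g-\epsilon,g)$ and $(g,g+\epsilon)$ have nonempty intersection with $C_A+C_A$ and nonempty intersection with the complement of $C_A+C_A$. *)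

(* Defs.v *)
From HB Require Import structures.
From mathcomp Require Import all_boot all_order all_algebra.
From mathcomp Require Import all_classical all_reals all_analysis.
Set Implicit Arguments.
Unset Strict Implicit.
Unset Printing Implicit Defensive.
Import Order.TTheory GRing.Theory Num.Theory.
Import numFieldNormedType.Exports.
Local Open Scope classical_set_scope.
Local Open Scope ring_scope.

Section Attractor.
Variable R : realType.

Definition digit_ifs (n : nat) (A : set nat) : set (R -> R) :=
  [set (fun x : R => (x + a%:R) / n%:R) | a in A].

(* For a finite nonempty family of contractions (Hutchinson) there is exactly
   one such K. *)
Definition is_attractor (F : set (R -> R)) (K : set R) : Prop :=
  [/\ K !=set0, compact K & K = \bigcup_(f in F) (f @` K)].

Definition minkowski_sum (X Y : set R) : set R := [set x + y | x in X & y in Y].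

End Attractor.

Section IntervalsGapsPoints.
Variable R : realType.
Implicit Types S X : set R.

Definition interval_in S X : Prop :=
  exists a b : R, [/\ a < b, X = `[a, b]%classic & X `<=` S].

Definition gap_in S X : Prop :=
  exists a b : R, [/\ a < b, X = `]a, b[%classic & X `&` S = set0].

Definition maximal_intervals S : set (set R) :=
  [set X | interval_in S X /\ ~ exists Y, interval_in S Y /\ X `<` Y].

Definition maximal_gaps S : set (set R) :=
  [set X | gap_in S X /\ ~ exists Y, gap_in S Y /\ X `<` Y].

Definition points_in S : set R :=
  [set g | S g /\ forall e : R, 0 < e ->
    [/\ `]g - e, g[%classic `&` S !=set0,
        `]g, g + e[%classic `&` S !=set0,
        `]g - e, g[%classic `&` ~` S !=set0
      & `]g, g + e[%classic `&` ~` S !=set0]].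

Definition boundary S : set R := closure S `&` closure (~` S).

Definition cantor_set S : Prop := S `<=` boundary S /\ isolated S = set0.

End IntervalsGapsPoints.

Section HausdorffDimension.
Variable R : realType.
Implicit Types X : set R.
Local Open Scope ereal_scope.

(* The maximum with 0 makes the diameter of the empty set equal to 0. *)
Definition diam X : \bar R :=
  maxe 0 (ereal_sup [set (`|x - y|%R)%:E | x in X & y in X]).

Definition hausdorff_content (s delta : R) X : \bar R :=
  ereal_inf [set \sum_(0 <= i <oo) diam (U i) `^ s | U in
    [set U : nat -> set R |
      X `<=` \bigcup_i U i /\ forall i, diam (U i) <= delta%:E]].

Definition hausdorff_measure (s : R) X : \bar R :=
  ereal_sup [set hausdorff_content s delta X | delta in [set d : R | (0 < d)%R]].

(* Only s > 0 is considered: this does not change the infimum, and it avoids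
   the value 0 `^ 0 = 1 that empty members of a cover would contribute. *)
Definition hausdorff_dim X : \bar R :=
  ereal_inf [set s%:E | s in
    [set s : R | (0 < s)%R /\ hausdorff_measure s X = 0]].

End HausdorffDimension.

(* Main.v *)
Require Import Defs.
From mathcomp Require Import all_boot all_order all_algebra.
From mathcomp Require Import all_classical all_reals all_analysis.
From mathcomp Require Import ring lra.
Import Order.TTheory GRing.Theory Num.Theory.
Import numFieldNormedType.Exports.
Local Open Scope classical_set_scope.
Local Open Scope ring_scope.

(** The set [S = C + C] is the attractor of the digit system with digit set
    [D = A + A]; it is compact, lies in [0, 2] and contains 0, 1 and 2, the fixed
    points of the contractions with digits 0, [n - 1] and [2 (n - 1)].

    If [S] contains no interval, it has empty interior, and self-similarity leaves
    no isolated point: [S] is a Cantor set. Otherwise, unless [S] is [0, 2], some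
    [w] in [0, 2] is missing from [S]. As 1 is in [S], either [0 < w < 1] or
    [1 < w < 2], and up to the reflection [x |-> 2 - x], which replaces [D] by
    [2 (n - 1) - D], the former holds.

    Near 0 only the copy of [S] with digit 0 is visible, so that inside the unit
    interval [S] is invariant under division by [n]. Hence the gap around [w] has
    infinitely many scaled copies, which are again maximal gaps
    ([maximal_gaps_infinite]), and an interval of [S], pushed close to 0 so as to be
    trapped between gaps, gives infinitely many maximal intervals
    ([maximal_intervals_infinite]). Both families are countable because distinct
    members have disjoint interiors.

    For the dimension, the point is that the part of [S] in the unit interval
    reappears undisturbed elsewhere than at the origin. At a fine enough scale some
    cell has its left end in the gap, so that no copy of [S] is placed there. At
    the first place to the right of it that does carry a copy, none is placed one
    step to the left, so the cell beginning there shows a single copy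
    ([gap_isolated_level], [replica_level]). Shrinking towards 0 and composing
    yields two contractions of the same ratio, with disjoint images inside ]0, w[, that respect membership and
    nonmembership in [S]. Every point of their attractor has members and nonmembers
    of [S] on both sides at every scale ([code_points_in]), and this attractor has
    positive dimension, because the inverse of its coding by binary expansions is
    Hoelder continuous onto the unit interval and Lebesgue measure then bounds the
    sums of the covers from below ([holder_section_hausdorff_measure_gt0]). *)

(** * Hausdorff dimension of the attractor of two contractions *)

Section HolderSections.
Local Set Implicit Arguments.
Local Unset Strict Implicit.
Variable R : realType.
Implicit Types (X : set R) (s K r : R).

Lemma exists_expr_lt (r e : R) : 0 <= r < 1 -> 0 < e -> exists k, r ^+ k < e.
Proof.
move=> /andP[r0 r1] e0; have rn1 : `|r| < 1 by rewrite ger0_norm.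
have [k _ /(_ k (leqnn k)) hk] := cvgr0_norm_lt _ (cvg_expr rn1) _ e0.
by exists k; move: hk; rewrite /= ger0_norm // exprn_ge0.
Qed.

Lemma le_diam X x y : X x -> X y -> (`|x - y|%:E <= diam X)%E.
Proof.
move=> Xx Xy; rewrite /diam le_max; apply/orP; right.
by apply: ereal_sup_ubound; exists x => //; exists y.
Qed.

(** Pulled back along [psi], a cover of [X] becomes a cover of the unit interval
    by sets contained in intervals of length [2 * K * diam ^ s]; the lengths sum
    to at least 1, the Lebesgue measure of the unit interval. *)
Lemma holder_section_hausdorff_measure_gt0 X s K (psi : R -> R) :
    0 < s -> 0 < K ->
    (forall y, 0 <= y < 1 -> X (psi y)) ->
    (forall y y', 0 <= y < 1 -> 0 <= y' < 1 ->
      `|y - y'| <= K * `|psi y - psi y'| `^ s) ->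
  (0 < hausdorff_measure s X)%E.
Proof.
move=> s0 K0 Xpsi holder.
apply: (@lt_le_trans _ _ ((2 * K)^-1)%:E).
  by rewrite lte_fin invr_gt0 mulr_gt0.
apply: (@le_trans _ _ (hausdorff_content s 1 X)); last first.
  by apply: ereal_sup_ubound; exists 1 => //=.
apply: le_ereal_inf_tmp => _ [U [cov dU] <-].
set Sum := limn _.
suff : (1 <= (2 * K)%:E * Sum)%E.
  by move=> h; rewrite -[((2 * K)^-1)%:E]mul1e lee_pdivrMr ?mulr_gt0 // muleC.
have dfin i : diam (U i) \is a fin_num.
  rewrite ge0_fin_numE; last by rewrite /diam le_max lexx.
  exact: le_lt_trans (dU i) (ltry _).
(* A point of the pulled back set, when there is one, serves as the centre of
   an interval of radius [l i] containing that set. *)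
pose l i := K * fine (diam (U i)) `^ s.
pose F i : set R :=
  if pselect (exists y, 0 <= y < 1 /\ U i (psi y)) is left e
  then `[projT1 (cid e) - l i, projT1 (cid e) + l i]%classic else set0.
have mF i : measurable (F i) by rewrite /F; case: pselect.
have l0 i : 0 <= l i by rewrite mulr_ge0 ?powR_ge0 // ltW.
have covF : (`[0, 1[%classic : set R) `<=` \bigcup_i F i.
  move=> y /=; rewrite in_itv/= => y01.
  have [i _ Uiy] := cov _ (Xpsi _ y01).
  exists i => //; rewrite /F; case: pselect => [e|[]]; last by exists y.
  case: cid => y0 /= [y001 Uiy0] /=; rewrite in_itv/=.
  have : `|y - y0| <= l i.
    apply: le_trans (holder _ _ y01 y001) _.
    rewrite ler_pM2l //; apply: ge0_ler_powR; rewrite ?nnegrE ?(ltW s0) //.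
      by rewrite fine_ge0 // /diam le_max lexx.
    by rewrite -lee_fin fineK // le_diam.
  by rewrite ler_distl.
have muF i : (lebesgue_measure (F i) <= (2 * K)%:E * diam (U i) `^ s)%E.
  have -> : ((2 * K)%:E * diam (U i) `^ s = (2 * l i)%:E)%E.
    by rewrite -{1}(fineK (dfin i)) poweR_EFin -EFinM /l mulrA.
  rewrite /F; case: pselect => [e|_]; last first.
    by rewrite measure0 lee_fin mulr_ge0.
  rewrite lebesgue_measure_itv/=; case: ifP => _; last by rewrite lee_fin mulr_ge0.
  by rewrite -EFinB lee_fin; lra.
have leb1 : lebesgue_measure (`[0, 1[%classic : set R) = 1%E.
  by rewrite lebesgue_measure_itv/= lte_fin ltr01 oppr0 adde0.
rewrite -leb1; apply: le_trans.
  apply: (measure_sigma_subadditive (@lebesgue_measure R) mF _ covF).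
  exact: measurable_itv.
apply: (@le_trans _ _ (\sum_(0 <= i <oo) ((2 * K)%:E * diam (U i) `^ s))%E).
  by apply: lee_nneseries => // i _; exact: muF.
by rewrite nneseriesZl // => i _; rewrite poweR_ge0.
Qed.

Definition leading_bit (y : R) : bool := 1 / 2 <= y.
Definition drop_leading_bit (y : R) : R := 2 * y - (leading_bit y)%:R.

Lemma drop_leading_bit_itv y : 0 <= y < 1 -> 0 <= drop_leading_bit y < 1.
Proof.
rewrite /drop_leading_bit /leading_bit => /andP[y0 y1].
by have [h|h] := lerP (1 / 2) y; apply/andP; rewrite ?mulr1n ?mulr0n; split; lra.
Qed.

Section TwoMaps.
Variables (r t0 t1 : R).
Hypotheses (r_gt0 : 0 < r) (t0_gt0 : 0 < t0) (t01_lt : t0 + r < t1).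
Hypothesis (t1_lt : t1 + r < 1).

Fixpoint code_approx (k : nat) (y : R) : R :=
  if k is k'.+1 then
    r * code_approx k' (drop_leading_bit y) + (if leading_bit y then t1 else t0)
  else 0.

(** The point of the attractor of [x |-> r x + t0] and [x |-> r x + t1] whose
    address is the binary expansion of [y]; it inverts the Cantor function of
    that attractor. *)
Definition code (y : R) : R := limn (code_approx ^~ y).

Lemma code_approx_itv k y : 0 <= code_approx k y <= 1.
Proof.
move: r_gt0 t0_gt0 t01_lt t1_lt => r0 t00 t01 t11.
elim: k y => [|k IH] y /=; first by rewrite lexx ler01.
have /andP[h1 h2] := IH (drop_leading_bit y).
have h3 : 0 <= r * code_approx k (drop_leading_bit y) by rewrite mulr_ge0 // ltW.
have h4 : r * code_approx k (drop_leading_bit y) <= r by rewrite ler_piMr // ltW.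
by case: leading_bit; apply/andP; split; lra.
Qed.

Lemma code_approx_cvg y : code_approx ^~ y @ \oo --> code y.
Proof.
move: r_gt0 t0_gt0 t01_lt t1_lt => r0 t00 t01 t11.
apply: nondecreasing_is_cvgn; last first.
  by exists 1 => _ [k _ <-]; have /andP[] := code_approx_itv k y.
apply/nondecreasing_seqP => k.
elim: k y => [|k IH] y; first by have /andP[] := code_approx_itv 1 y.
by rewrite /= lerD2r ler_pM2l //; exact: IH.
Qed.

Lemma code_rec y : code y =
  r * code (drop_leading_bit y) + (if leading_bit y then t1 else t0).
Proof.
have h1 : (fun k => code_approx k.+1 y) @ \oo --> code y.
  by have := @code_approx_cvg y; rewrite -cvg_shiftS.
have h2 : (fun k => code_approx k.+1 y) @ \oo -->
    r * code (drop_leading_bit y) + (if leading_bit y then t1 else t0).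
  by rewrite /=; apply: cvgD; [apply: cvgMr; exact: code_approx_cvg|exact: cvg_cst].
exact: cvg_unique h1 h2.
Qed.

Lemma code_itv y : 0 <= code y <= 1.
Proof.
have : `[0, 1]%classic (code y); last by rewrite /= in_itv.
apply: (closed_cvg _ _ _ _ (@code_approx_cvg y)); first exact: interval_closed.
by near=> k; rewrite /= in_itv; exact: code_approx_itv.
Unshelve. all: by end_near. Qed.

(** Different leading bits put the two codes in different first level copies,
    which are [t1 - t0 - r] apart. Equal leading bits reduce the claim to the
    shifted expansions: their distance is doubled, while that of the codes is
    divided by [r]. *)
Lemma code_expansion k (y y' : R) : 0 <= y < 1 -> 0 <= y' < 1 ->
  2^-1 ^+ k < `|y - y'| -> (t1 - t0 - r) * r ^+ k <= `|code y - code y'|.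
Proof.
move: r_gt0 t0_gt0 t01_lt t1_lt => r0 t00 t01 t11.
elim: k y y' => [|k IH] y y' y01 y'01.
  by rewrite expr0 => h; exfalso; move: h; rewrite ltr_normr; lra.
rewrite !exprS code_rec (code_rec y') => dy.
have h := IH _ _ (drop_leading_bit_itv y01) (drop_leading_bit_itv y'01).
have rk : r ^+ k <= 1 by rewrite exprn_ile1 //; lra.
have rk0 : 0 < r ^+ k by rewrite exprn_gt0.
have rc0 z : 0 <= z <= 1 -> 0 <= r * z <= r.
  by case/andP=> z0 z1; rewrite mulr_ge0 ?ler_piMr // ltW.
have /andP[h1 h2] := rc0 _ (code_itv (drop_leading_bit y)).
have /andP[h3 h4] := rc0 _ (code_itv (drop_leading_bit y')).
have rrk : (t1 - t0 - r) * (r * r ^+ k) <= t1 - t0 - r.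
  by rewrite ler_piMr ?mulr_ile1 //; lra.
have same c : drop_leading_bit y - drop_leading_bit y' = 2 * (y - y') ->
    (t1 - t0 - r) * (r * r ^+ k) <=
    `|r * code (drop_leading_bit y) + c - (r * code (drop_leading_bit y') + c)|.
  move=> shE; have -> :
    r * code (drop_leading_bit y) + c - (r * code (drop_leading_bit y') + c) =
    r * (code (drop_leading_bit y) - code (drop_leading_bit y')) by ring.
  rewrite normrM (gtr0_norm r0) mulrCA ler_pM2l //; apply: h.
  by rewrite shE normrM gtr0_norm //; lra.
move: same; rewrite {1}/drop_leading_bit {1}/drop_leading_bit.
case: (leading_bit y); case: (leading_bit y') => /= same.
- by apply: same; ring.
- by apply: le_trans (ler_norm _); lra.
- by rewrite distrC; apply: le_trans (ler_norm _); lra.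
- by apply: same; ring.
Qed.

Lemma code_holder s (y y' : R) : 0 < s -> 2^-1 <= r `^ s ->
    0 <= y < 1 -> 0 <= y' < 1 ->
  `|y - y'| <= 2 / (t1 - t0 - r) `^ s * `|code y - code y'| `^ s.
Proof.
move: r_gt0 t0_gt0 t01_lt t1_lt => r0 t00 t01 t11.
move=> s0 rs y01 y'01.
set d := t1 - t0 - r; have d0 : 0 < d by rewrite /d; lra.
have [->|neq] := eqVneq y y'.
  by rewrite subrr normr0 mulr_ge0 ?powR_ge0 // divr_ge0 ?powR_ge0.
have dy0 : 0 < `|y - y'| by rewrite normr_gt0 subr_eq0.
have exk : exists k, 2^-1 ^+ k < `|y - y'| by apply: exists_expr_lt => //; lra.
(* [k.+1] is the binary scale of the distance: it lies between
   [2^-1 ^+ k.+1] and [2^-1 ^+ k]. *)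
case: (ex_minnP exk) => -[|k] hk kmin.
  by exfalso; move: hk; rewrite expr0 ltr_normr; lra.
have {kmin} dyk : `|y - y'| <= 2^-1 ^+ k.
  by rewrite leNgt; apply/negP => /kmin; rewrite ltnn.
have := code_expansion y01 y'01 hk; rewrite -/d => hd.
have : (d * r ^+ k.+1) `^ s <= `|code y - code y'| `^ s.
  apply: ge0_ler_powR; rewrite ?nnegrE ?(ltW s0) //.
  by rewrite mulr_ge0 ?exprn_ge0 // ltW.
rewrite powRM ?exprn_ge0 ?(ltW d0) ?(ltW r0) // => hd'.
have ds : 0 < d `^ s by rewrite powR_gt0.
apply: le_trans dyk _.
apply: (@le_trans _ _ (2 / d `^ s * (d `^ s * (r ^+ k.+1) `^ s))); last first.
  by rewrite ler_pM2l // divr_gt0.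
rewrite mulrA divfK ?gt_eqF //.
have -> : (r ^+ k.+1) `^ s = (r `^ s) ^+ k.+1.
  by rewrite -(powR_mulrn _ (ltW r0)) -powRrM mulrC powRrM powR_mulrn ?powR_ge0.
have -> : 2^-1 ^+ k = 2 * 2^-1 ^+ k.+1 :> R.
  by rewrite exprS mulrA divff ?mul1r // pnatr_eq0.
by rewrite ler_pM2l // lerXn2r ?nnegrE ?powR_ge0 ?invr_ge0.
Qed.

End TwoMaps.

(** For [s] below the similarity dimension [ln 2 / - ln r] one has
    [1/2 <= r `^ s], so [code] is the inverse of an [s]-Hoelder map onto the
    unit interval and the [s]-dimensional measure is positive. *)
Lemma hausdorff_dim_two_maps_gt0 X r t0 t1 :
    0 < r -> 0 < t0 -> t0 + r < t1 -> t1 + r < 1 ->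
    (forall y, 0 <= y < 1 -> X (code r t0 t1 y)) ->
  (0 < hausdorff_dim X)%E.
Proof.
move=> r0 t00 t01 t11 XP.
have r1 : r < 1 by lra.
have lnr : ln r < 0 by rewrite ln_lt0 // r0.
apply: (@lt_le_trans _ _ (ln 2 / - ln r)%:E).
  by rewrite lte_fin divr_gt0 ?oppr_gt0 // ln_gt0 // ltr1n.
apply: le_ereal_inf_tmp => _ [s [s0 hs] <-].
rewrite lee_fin leNgt; apply/negP; rewrite ltr_pdivlMr ?oppr_gt0 // => slt.
suff : (0 < hausdorff_measure s X)%E by rewrite hs ltxx.
have rs : 2^-1 <= r `^ s.
  rewrite /powR gt_eqF // -[leLHS]lnK ?posrE ?invr_gt0 // ler_expR.
  by rewrite lnV ?posrE //; lra.
apply: (holder_section_hausdorff_measure_gt0 (psi := code r t0 t1)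
          (K := 2 / (t1 - t0 - r) `^ s)) => //.
  by rewrite divr_gt0 // powR_gt0; lra.
by move=> y y'; apply: code_holder.
Qed.

End HolderSections.

(** * Maximal intervals and maximal gaps of a set of reals *)

Section Maximal.
Local Set Implicit Arguments.
Local Unset Strict Implicit.
Variable R : realType.
Implicit Types (S X Y : set R) (F : set (set R)) (a b c w x y : R).

(** Each member contains a rational number, which determines it. *)
Lemma countable_fat_disjoint F :
    (forall X, F X -> exists a b, a < b /\ `]a, b[ `<=` X) ->
    (forall X Y, F X -> F Y -> X `&` Y !=set0 -> X = Y) ->
  countable F.
Proof.
move=> fat disj.
have Fq X : exists q : rat, F X -> X (ratr q).
  have [/fat [a [b [ab abX]]]|] := pselect (F X); last by exists 0.
  by have [q qab] := rat_in_itvoo ab; exists q => _; apply: abX.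
have [q qF] := choice Fq.
apply: (sub_countable (B := [set: rat])); last exact: countableP.
apply/pcard_injP; exists q => X Y; rewrite !inE => FX FY qXY.
by apply: disj => //; exists (ratr (q X)); split; [|rewrite qXY]; exact: qF.
Qed.

(** The bound [u k.+1], which is exceeded in [X k] but in no later set, tells the
    members of the family apart. *)
Lemma infinite_decreasing_family F (u : nat -> R) (X : nat -> set R) :
    (forall k, u k.+1 <= u k) ->
    (forall k, F (X k)) ->
    (forall k x, X k x -> x <= u k) ->
    (forall k, exists2 x, X k x & u k.+1 < x) ->
  infinite_set F.
Proof.
move=> udec FX Xu Xlt Ffin.
have Xneq k l : (k < l)%N -> X k <> X l.
  move=> kl XE; have [x] := Xlt k; rewrite XE => /Xu xl.
  rewrite ltNge => /negP; apply; apply: le_trans xl _.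
  have hu : {homo u : i j / (i <= j)%N >-> j <= i}.
    by apply/nonincreasing_seqP.
  exact: hu.
have Xinj : {in [set: nat] &, injective X}.
  move=> k l _ _ XE; have [/Xneq|/Xneq|//] := ltngtP k l; first by case.
  by move=> h; case: h.
apply: infinite_nat; rewrite -(eq_finite_set (inj_card_eq Xinj)).
by apply: sub_finite_set Ffin => _ [k _ <-].
Qed.

(** Two overlapping intervals in [S] have an interval as their union, so by
    maximality both coincide with it; the same for gaps. *)
Lemma countable_maximal_intervals S : countable (maximal_intervals S).
Proof.
apply: countable_fat_disjoint.
  move=> _ [[a [b [ab -> _]]] _]; exists a, b; split=> //.
  by apply: subset_itvW.
suff H X Y : maximal_intervals S X -> maximal_intervals S Y ->
    X `&` Y !=set0 -> X `<=` Y.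
  move=> X Y MX MY XY; apply/seteqP; split; first exact: H.
  by apply: H => //; rewrite setIC.
move=> [[a [b [ab -> abS]]] _] [[c [d [cd -> cdS]]] maxY] [z []].
rewrite /= !in_itv/= => /andP[az zb] /andP[cz zd] x.
rewrite /= !in_itv/= => /andP[ax xb].
apply: contrapT => xcd; apply: maxY.
exists `[Num.min a c, Num.max b d]%classic; split.
  exists (Num.min a c), (Num.max b d); split => //.
    by rewrite lt_max gt_min ab.
  move=> y; rewrite /= in_itv/= ge_min le_max => /andP[h1 h2].
  have [zy|yz] := leP z y.
    by case/orP: h2 => h2; [apply: abS|apply: cdS];
      rewrite /= in_itv/=; apply/andP; split; lra.
  by case/orP: h1 => h1; [apply: abS|apply: cdS];
    rewrite /= in_itv/=; apply/andP; split; lra.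
split.
  by move=> y; rewrite /= !in_itv/= ge_min le_max => /andP[-> ->]; rewrite !orbT.
by move=> /(_ x) h; apply: xcd; have := h; rewrite /= !in_itv/= ge_min le_max ax xb; apply.
Qed.

Lemma countable_maximal_gaps S : countable (maximal_gaps S).
Proof.
apply: countable_fat_disjoint.
  by move=> _ [[a [b [ab -> _]]] _]; exists a, b; split.
suff H X Y : maximal_gaps S X -> maximal_gaps S Y ->
    X `&` Y !=set0 -> X `<=` Y.
  move=> X Y MX MY XY; apply/seteqP; split; first exact: H.
  by apply: H => //; rewrite setIC.
move=> [[a [b [ab -> abS]]] _] [[c [d [cd -> cdS]]] maxY] [z []].
rewrite /= !in_itv/= => /andP[az zb] /andP[cz zd] x.
rewrite /= !in_itv/= => /andP[ax xb].
apply: contrapT => xcd; apply: maxY.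
exists `]Num.min a c, Num.max b d[%classic; split.
  exists (Num.min a c), (Num.max b d); split => //.
    by rewrite lt_max gt_min ab.
  rewrite -subset0 => y [] /=; rewrite in_itv/= gt_min lt_max => /andP[h1 h2] Sy.
  suff : (`]a, b[ `|` `]c, d[) y.
    case=> yI; first by have : (`]a, b[ `&` S) y by []; rewrite abS.
    by have : (`]c, d[ `&` S) y by []; rewrite cdS.
  rewrite /= !in_itv/=.
  have [zy|yz] := leP z y.
    by case/orP: h2 => h2; [left|right]; apply/andP; split; lra.
  by case/orP: h1 => h1; [left|right]; apply/andP; split; lra.
split.
  by move=> y; rewrite /= !in_itv/= gt_min lt_max => /andP[-> ->]; rewrite !orbT.
by move=> /(_ x) h; apply: xcd; have := h; rewrite /= !in_itv/= gt_min lt_max ax xb; apply.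
Qed.

Lemma maximal_gap_of_endpoints S a b : a < b -> S a -> S b ->
  (forall x, a < x < b -> ~ S x) -> maximal_gaps S `]a, b[%classic.
Proof.
move=> ab Sa Sb Sab; split.
  exists a, b; split => //; rewrite -subset0 => x [] /=.
  by rewrite in_itv => /Sab.
move=> [_ [[c [d [cd -> cdS]]] [sub]]]; apply => x /=; rewrite !in_itv/= => /andP[cx xd].
have out y : S y -> ~ c < y < d.
  by move=> Sy cyd; have : (`]c, d[ `&` S) y by []; rewrite cdS.
have hm : c < (a + b) / 2 < d.
  by have := sub ((a + b) / 2); rewrite /= !in_itv/=; apply; apply/andP; split; lra.
case/andP: hm => h1 h2.
have h3 : a <= c by rewrite leNgt; apply/negP => ca; apply: (out _ Sa); rewrite ca; lra.
have h4 : d <= b by rewrite leNgt; apply/negP => ca; apply: (out _ Sb); rewrite ca; lra.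
by apply/andP; split; lra.
Qed.

(** These two conditions say that an interval contained in [S] cannot be
    prolonged beyond its end point; unlike maximality, they are local and hence
    pass to scaled copies. *)
Definition nonmembers_below S a := forall x, x < a -> exists2 y, x < y < a & ~ S y.
Definition nonmembers_above S b := forall x, b < x -> exists2 y, b < y < x & ~ S y.

Lemma maximal_interval_of_ends S a b : a < b -> `[a, b] `<=` S ->
  nonmembers_below S a -> nonmembers_above S b ->
  maximal_intervals S `[a, b]%classic.
Proof.
move=> ab abS Na Nb; split; first by exists a, b.
move=> [_ [[c [d [cd -> cdS]]] [sub]]]; apply => x /=; rewrite !in_itv/= => /andP[cx xd].
have h1 : c <= a <= d by have := sub a; rewrite /= !in_itv/=; apply; rewrite lexx ltW.
have h2 : c <= b <= d by have := sub b; rewrite /= !in_itv/=; apply; rewrite lexx ltW.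
case/andP: h1 => h1 h1'; case/andP: h2 => h2 h2'.
apply/andP; split; rewrite leNgt; apply/negP => h.
  have [y /andP[y1 y2]] := Na _ h; apply; apply: cdS; rewrite /= in_itv/=.
  by apply/andP; split; lra.
have [y /andP[y1 y2]] := Nb _ h; apply; apply: cdS; rewrite /= in_itv/=.
by apply/andP; split; lra.
Qed.

Lemma closed_oppr S : closed S -> closed [set x | S (- x)].
Proof.
by move=> cS; apply: (closed_comp (f := -%R)) => // x _; exact: opp_continuous.
Qed.

(** The left end point of the gap around [w]; it is attained as [S] is closed. *)
Lemma closed_last_before S p w : closed S -> S p -> p <= w -> ~ S w ->
  exists a, [/\ S a, p <= a < w & forall x, a < x <= w -> ~ S x].
Proof.
move=> cS Sp pw NSw; pose E : set R := [set x | S x /\ x <= w].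
have Ep : E p by [].
have Eub : has_ubound E by exists w => x [].
have [] : E (sup E).
  have : closure E (sup E) by apply: closure_sup => //; exists p.
  suff cE : closed E by move=> /cE.
  have -> : E = S `&` `]-oo, w]%classic.
    by apply/seteqP; split => x /=; rewrite in_itv.
  by apply: closedI => //; exact: interval_closed.
move=> Sa aw; exists (sup E); split => //.
  rewrite ub_le_sup //= lt_neqAle aw andbT.
  by apply/eqP => e; apply: NSw; rewrite -e.
move=> x /andP[ax xw] Sx; have : x <= sup E by apply: ub_le_sup.
by rewrite leNgt ax.
Qed.

Lemma closed_first_after S p w : closed S -> S p -> w <= p -> ~ S w ->
  exists b, [/\ S b, w < b <= p & forall x, w <= x < b -> ~ S x].
Proof.
move=> /closed_oppr cS Sp wp NSw.
have [|||a [Sa aw Na]] := closed_last_before (p := - p) (w := - w) cS.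
- by rewrite /= opprK.
- by rewrite lerN2.
- by rewrite /= opprK.
exists (- a); split=> //; first by lra.
by move=> x xw Sx; apply: (Na (- x)); [lra|rewrite /= opprK].
Qed.

(** The left end point of the component of [c]. *)
Lemma closed_interval_left_end S e c : closed S -> e < c -> ~ S e -> S c ->
  exists a, [/\ e < a <= c, `[a, c] `<=` S & nonmembers_below S a].
Proof.
move=> cS ec NSe Sc; pose E : set R := [set x | ~ S x /\ x < c].
have Ee : E e by [].
have E0 : E !=set0 by exists e.
have Eub : has_ubound E by exists c => x [_ /ltW].
have ac : sup E <= c by apply: ge_sup => // x [_ /ltW].
have inS x : sup E < x <= c -> S x.
  move=> /andP[ax]; rewrite le_eqVlt => /orP[/eqP -> //|xc].
  apply: contrapT => NSx; have : x <= sup E by apply: ub_le_sup.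
  by rewrite leNgt ax.
have Sa : S (sup E).
  apply: contrapT => NSa.
  have ac' : sup E < c by rewrite lt_neqAle ac andbT; apply/eqP => h; rewrite h in NSa.
  have : ~ S (sup E) by [].
  apply; apply: cS => B /nbhs_ballP[d /= d0 dB].
  exists (Num.min c (sup E + d / 2)); split.
    by apply: inS; rewrite lt_min ge_min lexx ac' ltrDl divr_gt0.
  apply: dB; rewrite /ball/= ltr_norml.
  by have [h|h] := leP c (sup E + d / 2); apply/andP; split; lra.
exists (sup E); split.
- rewrite ac andbT lt_neqAle ub_le_sup // andbT.
  by apply/eqP => h; rewrite -h in Sa.
- move=> x /=; rewrite in_itv/= le_eqVlt => /andP[/orP[/eqP <- //|ax] xc].
  by apply: inS; rewrite ax.
- move=> x xa; have d0 : 0 < sup E - x by rewrite subr_gt0.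
  have [y [NSy yc]] := sup_adherent d0 (conj E0 Eub); rewrite subKr => xy.
  exists y => //; rewrite xy lt_neqAle ub_le_sup // andbT.
  by apply/eqP => h; rewrite -h in Sa.
Qed.

Lemma closed_interval_right_end S d g : closed S -> d < g -> ~ S g -> S d ->
  exists b, [/\ d <= b < g, `[d, b] `<=` S & nonmembers_above S b].
Proof.
move=> /closed_oppr cS dg NSg Sd.
have [|||a [ha aS Na]] := closed_interval_left_end (e := - g) (c := - d) cS.
- by rewrite ltrN2.
- by rewrite /= opprK.
- by rewrite /= opprK.
exists (- a); split; first by lra.
- move=> x; rewrite /= in_itv/= => hx; have := aS (- x).
  by rewrite /= in_itv/= opprK; apply; lra.
- move=> x hx; have [|y hy NSy] := Na (- x); first by lra.
  by exists (- y) => //; lra.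
Qed.

End Maximal.

(** * Invariance under reflection *)

Section Reflection.
Local Set Implicit Arguments.
Local Unset Strict Implicit.
Variables (R : realType) (c : R).
Implicit Types S X Y : set R.

Definition reflect_set X : set R := [set c - x | x in X].

Lemma reflect_setP X x : reflect_set X x <-> X (c - x).
Proof.
split=> [[y Xy <-]|Xx]; first by rewrite subKr.
by exists (c - x) => //; rewrite subKr.
Qed.

Lemma reflect_setK : involutive reflect_set.
Proof.
by move=> X; apply/seteqP; split => x; rewrite !reflect_setP subKr.
Qed.

Lemma reflect_set_sub X Y : X `<=` Y -> reflect_set X `<=` reflect_set Y.
Proof. exact: image_subset. Qed.

(** Reflection is an involution that preserves inclusion and [I], hence it
    permutes the maximal objects. *)
Lemma card_maximal_reflect (I : set R -> set R -> Prop) S :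
    (forall T X, I T X -> I (reflect_set T) (reflect_set X)) ->
  ([set X | I (reflect_set S) X /\
      ~ exists Y, I (reflect_set S) Y /\ X `<` Y] #=
   [set X | I S X /\ ~ exists Y, I S Y /\ X `<` Y])%card.
Proof.
move=> Irefl.
pose M T := [set X | I T X /\ ~ exists Y, I T Y /\ X `<` Y].
have Mrefl T X : M T X -> M (reflect_set T) (reflect_set X).
  move=> [IX maxX]; split; first exact: Irefl.
  move=> [Y [IY [XY YX]]]; apply: maxX; exists (reflect_set Y); split.
    by rewrite -[T]reflect_setK; apply: Irefl.
  split; first by rewrite -[X]reflect_setK; apply: reflect_set_sub.
  by move=> h; apply: YX; rewrite -[Y]reflect_setK; apply: reflect_set_sub.
have -> : [set X | I (reflect_set S) X /\
      ~ exists Y, I (reflect_set S) Y /\ X `<` Y] = reflect_set @` M S.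
  apply/seteqP; split => [X MX|_ [X MX <-]]; last exact: Mrefl.
  exists (reflect_set X); last exact: reflect_setK.
  by rewrite -[S]reflect_setK; apply: Mrefl.
by apply: inj_card_eq => X Y _ _; exact: (can_inj reflect_setK).
Qed.

Lemma interval_in_reflect S X :
  interval_in S X -> interval_in (reflect_set S) (reflect_set X).
Proof.
move=> [a [b [ab -> abS]]]; exists (c - b), (c - a); split.
- by lra.
- by apply/seteqP; split => x; rewrite reflect_setP /= !in_itv/=; lra.
- exact: reflect_set_sub.
Qed.

Lemma gap_in_reflect S X :
  gap_in S X -> gap_in (reflect_set S) (reflect_set X).
Proof.
move=> [a [b [ab -> abS]]]; exists (c - b), (c - a); split.
- by lra.
- by apply/seteqP; split => x; rewrite reflect_setP /= !in_itv/=; lra.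
- rewrite -subset0 => x [] /reflect_setP xI /reflect_setP xS.
  by have : (`]a, b[ `&` S) (c - x) by []; rewrite abS.
Qed.

Lemma points_in_reflect S : points_in (reflect_set S) = reflect_set (points_in S).
Proof.
suff sub T : reflect_set (points_in T) `<=` points_in (reflect_set T).
  apply/seteqP; split; last exact: sub.
  move=> x xP; apply/reflect_setP; rewrite -[S]reflect_setK.
  by apply: sub; exists x.
move=> _ [g [Tg gP] <-]; split; first by exists g.
move=> e e0; have [h1 h2 h3 h4] := gP e e0; split.
- case: h2 => x [] /= ix Tx; exists (c - x); split => /=; last by exists x.
  by move: ix; rewrite !in_itv/=; lra.
- case: h1 => x [] /= ix Tx; exists (c - x); split => /=; last by exists x.
  by move: ix; rewrite !in_itv/=; lra.
- case: h4 => x [] /= ix Tx; exists (c - x); split => /=; last first.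
    by move/reflect_setP; rewrite subKr.
  by move: ix; rewrite !in_itv/=; lra.
- case: h3 => x [] /= ix Tx; exists (c - x); split => /=; last first.
    by move/reflect_setP; rewrite subKr.
  by move: ix; rewrite !in_itv/=; lra.
Qed.

Lemma diam_reflect X : diam (reflect_set X) = diam X.
Proof.
rewrite /diam; congr (maxe _ (ereal_sup _)); apply/seteqP; split.
  move=> _ [_ [x Xx <-] [_ [y Xy <-] <-]]; exists x => //; exists y => //.
  by rewrite distrC; congr (`|_|%:E); ring.
move=> _ [x Xx [y Xy <-]]; exists (c - x); first by exists x.
exists (c - y); first by exists y.
by rewrite distrC; congr (`|_|%:E); ring.
Qed.

Lemma hausdorff_measure_reflect s X :
  (hausdorff_measure s X <= hausdorff_measure s (reflect_set X))%E.
Proof.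
apply: ge_ereal_sup => _ [d d0 <-].
apply: (@le_trans _ _ (hausdorff_content s d (reflect_set X))); last first.
  by apply: ereal_sup_ubound; exists d.
apply: ereal_inf_le_tmp => _ [U [cov dU] <-].
exists (reflect_set \o U); last first.
  by congr (limn _); apply/funext => k; apply: eq_bigr => i _; rewrite /= diam_reflect.
split=> [x Xx|i /=]; last by rewrite diam_reflect.
have [|i _ Ui] := cov (c - x); first by exists x.
by exists i => //=; apply/reflect_setP.
Qed.

Lemma hausdorff_dim_reflect X :
  (hausdorff_dim X <= hausdorff_dim (reflect_set X))%E.
Proof.
apply: ereal_inf_le_tmp => _ [s [s0 hs] <-]; exists s => //; split => //.
apply/eqP; rewrite eq_le -{1}hs hausdorff_measure_reflect /=.
apply: le_trans (ereal_sup_ubound _); last by exists 1 => //=.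
apply: le_ereal_inf_tmp => _ [U _ <-].
by apply: nneseries_ge0 => i _ _; rewrite poweR_ge0.
Qed.

Definition infinitely_fragmented S :=
  [/\ (maximal_intervals S #= [set: nat])%card,
      (maximal_gaps S #= [set: nat])%card
    & (0 < hausdorff_dim (points_in S))%E].

Lemma infinitely_fragmented_reflect S :
  infinitely_fragmented (reflect_set S) -> infinitely_fragmented S.
Proof.
move=> [iS gS dS]; split.
- apply: card_eq_trans iS; rewrite card_eq_sym.
  exact: card_maximal_reflect interval_in_reflect.
- apply: card_eq_trans gS; rewrite card_eq_sym.
  exact: card_maximal_reflect gap_in_reflect.
- apply: lt_le_trans dS _; rewrite points_in_reflect.
  by rewrite -{2}[points_in S]reflect_setK; exact: hausdorff_dim_reflect.
Qed.

End Reflection.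

(** * Attractors of digit systems with digits up to [2 (n - 1)] *)

Section DigitAttractor.
Local Set Implicit Arguments.
Local Unset Strict Implicit.
Variable R : realType.

(** The integers [\sum_(i < k) d_i * n ^ i] with digits [d_i] in [D]: the set
    [S] is the union of the copies [(S + w) / n ^ k] over such [w]. *)
Fixpoint level (n : nat) (D : set nat) (k : nat) : set nat :=
  if k is k'.+1 then [set (n * w + d)%N | w in level n D k' & d in D]
  else [set 0%N].

(** The properties of [A + A] on which the proof rests. They put 0, 1 and 2 in the
    attractor, and [d |-> 2 (n - 1) - d] preserves them, which accounts for the
    reflection [x |-> 2 - x]. *)
Definition spanning_digits (n : nat) (D : set nat) : Prop :=
  [/\ D `<=` [set d | (d <= n.-1 + n.-1)%N], D 0%N, D n.-1 & D (n.-1 + n.-1)%N].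

Variables (n : nat) (D : set nat) (S : set R).
Hypotheses (n_ge2 : (2 <= n)%N) (DP : spanning_digits n D).
Hypothesis attrS : is_attractor (@digit_ifs R n D) S.

Local Notation N := (n%:R : R).

Lemma base_ge2 : 2 <= N. Proof. by rewrite ler_nat. Qed.

Lemma base_gt0 : 0 < N. Proof. by rewrite ltr0n; case: n n_ge2. Qed.

Lemma base_predE : n.-1%:R = N - 1 :> R.
Proof. by case: n n_ge2 => // m _; rewrite -natr1 addrK. Qed.

Lemma base_inv_itv : 0 <= N^-1 < 1.
Proof.
by have := base_ge2; rewrite invr_ge0 ler0n /= => h; rewrite invf_lt1; lra.
Qed.

Lemma attractor_step x : S x <-> exists2 s, S s & exists2 d, D d & x = (s + d%:R) / N.
Proof.
have [_ _ SE] := attrS; split.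
  by rewrite {1}SE => -[_ [d Dd <-] [s Ss <-]]; exists s => //; exists d.
move=> [s Ss [d Dd ->]]; rewrite SE; exists (fun x : R => (x + d%:R) / N).
  by exists d.
by exists s.
Qed.

Lemma attractor_closed : closed S.
Proof. by have [_ cS _] := attrS; apply: compact_closed cS; exact: Rhausdorff. Qed.

(** The infimum [m] and the supremum [M] satisfy [m / n <= m] and
    [M <= (M + 2 (n - 1)) / n]. *)
Lemma attractor_itv x : S x -> 0 <= x <= 2.
Proof.
have [S0 cS _] := attrS; have [Dle _ _ _] := DP; have N2 := base_ge2.
have [M [_ /(_ (M + 1))]] := compact_bounded cS.
rewrite ltrDl ltr01 => /(_ isT) bS.
have Sub : has_ubound S by exists (M + 1) => y /bS /ler_normlP[].
have Slb : has_lbound S by exists (- (M + 1)) => y /bS /ler_normlP[]; lra.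
have step y : S y -> inf S / N <= y <= (sup S + 2 * (N - 1)) / N.
  move=> /attractor_step[s Ss [d /Dle /= dle ->]].
  rewrite !ler_pM2r ?invr_gt0 ?base_gt0 //.
  have s1 : inf S <= s by apply: ge_inf.
  have s2 : s <= sup S by apply: ub_le_sup.
  have d2 : d%:R <= 2 * (N - 1).
    by rewrite -base_predE mulrDl mul1r -natrD ler_nat.
  have d0 := ler0n R d; apply/andP; split; lra.
have inf0 : 0 <= inf S.
  have : inf S / N <= inf S by apply: lb_le_inf => // y /step/andP[].
  rewrite ler_pdivrMr ?base_gt0 // => h; nra.
have sup2 : sup S <= 2.
  have : sup S <= (sup S + 2 * (N - 1)) / N by apply: ge_sup => // y /step/andP[].
  rewrite ler_pdivlMr ?base_gt0 // => h; nra.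
move=> Sx; apply/andP; split.
  by apply: le_trans inf0 _; apply: ge_inf.
by apply: le_trans sup2; apply: ub_le_sup.
Qed.

(** [q] is the fixed point of the contraction with digit [d], hence the limit of
    the iterates of any point of [S]. *)
Lemma attractor_fixpoint d q : D d -> q * (N - 1) = d%:R -> S q.
Proof.
move=> Dd qd; have [[p Sp] _ _] := attrS.
have Sk k : S (q + (p - q) * N^-1 ^+ k).
  elim: k => [|k IH]; first by rewrite expr0 mulr1 subrKC.
  apply/attractor_step; exists (q + (p - q) * N^-1 ^+ k) => //.
  exists d => //; rewrite -qd exprS; field.
  by rewrite pnatr_eq0; case: n n_ge2.
apply: attractor_closed => B /nbhs_ballP[e /= e0 eB].
have [|k hk] := @exists_expr_lt _ N^-1 (e / (`|p - q| + 1)) base_inv_itv.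
  by rewrite divr_gt0 // ltr_wpDl.
exists (q + (p - q) * N^-1 ^+ k); split => //; apply: eB.
rewrite /ball/= opprD addNKr normrN normrM.
rewrite [`|N^-1 ^+ k|]ger0_norm ?exprn_ge0 ?invr_ge0 //.
move: hk; rewrite ltr_pdivlMr ?ltr_wpDl // mulrC; apply: le_lt_trans.
by rewrite ler_wpM2r ?lerDl // exprn_ge0 // invr_ge0.
Qed.

Lemma attractor0 : S 0.
Proof. by have [_ D0 _ _] := DP; apply: (attractor_fixpoint D0); rewrite mul0r. Qed.

Lemma attractor1 : S 1.
Proof.
have [_ _ D1 _] := DP; apply: (attractor_fixpoint D1).
by rewrite mul1r base_predE.
Qed.

Lemma attractor2 : S 2.
Proof.
have [_ _ _ D2] := DP; apply: (attractor_fixpoint D2).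
by rewrite natrD base_predE; ring.
Qed.

Lemma level0 k : level n D k 0%N.
Proof.
have [_ D0 _ _] := DP; elim: k => [|k IH] //=.
by exists 0%N => //; exists 0%N; rewrite // muln0.
Qed.

Lemma level_last k : level n D k (n ^ k).-1.
Proof.
have [_ _ D1 _] := DP; elim: k => [|k IH] //=.
exists (n ^ k).-1 => //; exists n.-1 => //.
have n0 : (0 < n)%N := ltnW n_ge2.
have : (0 < n ^ k)%N by rewrite expn_gt0 n0.
rewrite expnS; case: (n ^ k)%N => // m _.
by rewrite /= mulnS addnC; move: (n * m)%N => q; case: (n) n0.
Qed.

Lemma attractor_level k x :
  S x <-> exists2 s, S s & exists2 w, level n D k w & x = (s + w%:R) / N ^+ k.
Proof.
have N0 := base_gt0.
elim: k x => [|k IH] x.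
  split=> [Sx|[s Ss [w -> ->]]]; last by rewrite expr0 divr1 addr0.
  by exists x => //; exists 0%N; rewrite // expr0 divr1 addr0.
split.
  move=> /IH[s /attractor_step[s' Ss' [d Dd ->]] [w lw ->]].
  exists s' => //; exists (n * w + d)%N; first by exists w => //; exists d.
  rewrite natrD natrM exprS; field.
  by rewrite expf_neq0 gt_eqF.
move=> [s Ss [_ [w lw [d Dd <-]] ->]]; apply/IH.
exists ((s + d%:R) / N); first by apply/attractor_step; exists s => //; exists d.
exists w => //; rewrite natrD natrM exprS; field.
by rewrite expf_neq0 gt_eqF.
Qed.

(** The part of [S] lying over the interval [t, t + r] is an exact scaled copy of
    the part lying over the unit interval. *)
Definition replica (r t : R) : Prop :=
  [/\ 0 < r, 0 <= t, t + r <= 1 & forall x, 0 <= x <= 1 -> (S (r * x + t) <-> S x)].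

Lemma replica_comp r t r' t' :
  replica r t -> replica r' t' -> replica (r * r') (r * t' + t).
Proof.
move=> [r0 t0 rt1 rS] [r'0 t'0 rt'1 rS']; split.
- exact: mulr_gt0.
- by rewrite addr_ge0 // mulr_ge0 // ltW.
- apply: le_trans rt1; rewrite addrAC -mulrDr addrC lerD2l.
  by rewrite ger_pMr // addrC.
- move=> x x01; rewrite -mulrA addrA -mulrDr -[X in _ <-> X]rS' // rS //.
  case/andP: x01 => x0 x1; apply/andP; split.
    by rewrite addr_ge0 // mulr_ge0 // ltW.
  by apply: le_trans rt'1; rewrite addrC lerD2l ger_pMr.
Qed.

(** As [S] has length 2, only the copies of [S] placed at [j] and at [j.-1] reach
    the interior of the cell between [j] and [j.+1]; the hypothesis leaves the
    first of them. The end points of the cell may be reached from further copies,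
    but they belong to [S] anyway since 0 and 1 do. *)
Lemma replica_level k j : (j < n ^ k)%N -> level n D k j ->
  (j = 0%N \/ ~ level n D k j.-1) -> replica (N^-1 ^+ k) (j%:R * N^-1 ^+ k).
Proof.
move=> jk lj lj1; have N0 := base_gt0.
have Nk0 : 0 < N^-1 ^+ k by rewrite exprn_gt0 ?invr_gt0.
split; [by []|exact: mulr_ge0 (ler0n _ _) (ltW Nk0)| |].
  rewrite -{2}[N^-1 ^+ k]mul1r -mulrDl exprVn ler_pdivrMr ?exprn_gt0 // mul1r.
  by rewrite -natrX natr1 ler_nat.
move=> x /andP[x0 x1].
have -> : N^-1 ^+ k * x + j%:R * N^-1 ^+ k = (x + j%:R) / N ^+ k.
  by rewrite -exprVn; ring.
split=> [/attractor_level -/(_ k) [s Ss [w lw]]|Sx]; last first.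
  by apply/(attractor_level k); exists x => //; exists j.
have Nk : N ^+ k != 0 by rewrite expf_neq0 // gt_eqF.
move=> /(mulIf (invr_neq0 Nk)) xs; have /andP[s0 s2] := attractor_itv Ss.
have [wj|jw|wj] := ltngtP w j.
- have [wj1|wj1] := eqVneq w.+1 j.
    (* The copy placed at [j.-1] is the excluded one. *)
    case: lj1 => [j0|[]]; first by rewrite j0 in wj.
    by rewrite -wj1.
  (* A copy further left can only touch the cell at its left end. *)
  have : (w.+2 <= j)%N by rewrite ltn_neqAle wj1 wj.
  rewrite -(ler_nat R) -!natr1 => h.
  have -> : x = 0 by lra.
  exact: attractor0.
(* A copy further right can only touch the cell at its right end. *)
- move: jw; rewrite -(ler_nat R) -natr1 => h.
  have -> : x = 1 by lra.
  exact: attractor1.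
- have -> // : x = s.
  by move: xs; rewrite wj; apply: addIr.
Qed.

Lemma replica_origin k : replica (N^-1 ^+ k) 0.
Proof.
rewrite -[X in replica _ X](mul0r (N^-1 ^+ k)).
apply: (@replica_level k 0%N); [|exact: level0|by left].
by rewrite expn_gt0; case: n n_ge2.
Qed.

Lemma contract_origin k x : S x -> S (x * N^-1 ^+ k).
Proof.
move=> Sx; apply/(attractor_level k); exists x => //.
by exists 0%N; [exact: level0|rewrite addr0 exprVn].
Qed.

(** At a fine scale the cell of [w] has its left end [j0] in the gap, hence
    outside of [level n D k], while the last index [(n ^ k).-1] belongs to it. The
    first index of the level to the right of [j0] has no left neighbour in the
    level. *)
Lemma gap_isolated_level w : 0 < w < 1 -> ~ S w ->
  exists k j, [/\ (0 < j < n ^ k)%N, level n D k j & ~ level n D k j.-1].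
Proof.
move=> /andP[w0 w1] NSw; have N0 := base_gt0.
(* Only the part of the gap to the left of [w] is used: [w] is rounded down. *)
have [e e0 eS] : exists2 e, 0 < e & forall x, w - e < x <= w -> ~ S x.
  have [a [Sa /andP[a0 aw] aN]] :=
    closed_last_before attractor_closed attractor0 (ltW w0) NSw.
  by exists (w - a) => [|x]; [rewrite subr_gt0|rewrite subKr; exact: aN].
have [k hk] := exists_expr_lt base_inv_itv e0.
have Nk : 0 < N ^+ k by rewrite exprn_gt0.
pose j0 := Num.trunc (w * N ^+ k).
have /andP[j0w wj0] : j0%:R <= w * N ^+ k < j0.+1%:R.
  by rewrite truncn_itv // mulr_ge0 // ltW.
have NSj : ~ S (j0%:R / N ^+ k).
  apply: eS; rewrite ler_pdivrMr // j0w andbT ltr_pdivlMr // mulrBl.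
  move: hk; rewrite exprVn -[X in X < _]mul1r ltr_pdivrMr // => hk.
  by move: wj0; rewrite -natr1; lra.
have Nl0 : ~ level n D k j0.
  move=> l0; apply: NSj; apply/(attractor_level k); exists 0; first exact: attractor0.
  by exists j0 => //; rewrite add0r.
have j0k : (j0 < n ^ k)%N.
  rewrite -(ltr_nat R) natrX; apply: le_lt_trans j0w _.
  by rewrite gtr_pMl.
have nk0 : (0 < n ^ k)%N by apply: leq_ltn_trans j0k.
have j0last : (j0 < (n ^ k).-1)%N.
  rewrite ltn_neqAle -ltnS prednK // j0k andbT.
  by apply/eqP => h; apply: Nl0; rewrite h; exact: level_last.
have exj : exists j, (j0 < j)%N && `[< level n D k j >].
  by exists (n ^ k).-1; rewrite j0last; exact/asboolP/level_last.
case: (ex_minnP exj) => j /andP[j0j /asboolP lj] jmin.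
have j_gt0 : (0 < j)%N by apply: leq_ltn_trans j0j.
exists k, j; split => //.
  rewrite j_gt0 /= -(prednK nk0) ltnS.
  by apply: jmin; rewrite j0last; exact/asboolP/level_last.
move=> lj1; have [j0j1|jj0] := ltnP j0 j.-1.
  have /jmin : (j0 < j.-1)%N && `[< level n D k j.-1 >].
    by rewrite j0j1; exact/asboolP.
  by rewrite leqNgt ltn_predL j_gt0.
apply: Nl0; suff -> : j0 = j.-1 by [].
by apply/eqP; rewrite eqn_leq jj0 andbT -ltnS prednK.
Qed.

(** A code [g] lies strictly between 0 and [w]. To its left there are members and
    nonmembers of [S] close to 0, namely scaled copies of 1 and of [w]; to its right
    there are [w] and 1. This holds for all codes, and replicas carry members to
    members and nonmembers to nonmembers, so that the same holds at scale
    [r ^+ k] around every code, by induction on [k]. *)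
Lemma code_points_in r t0 t1 w : replica r t0 -> replica r t1 ->
    0 < t0 -> t0 + r < t1 -> t1 + r < w -> w < 1 -> ~ S w ->
  forall y, 0 <= y < 1 -> points_in S (code r t0 t1 y).
Proof.
move=> rep0 rep1 t00 t01 t1w w1 NSw.
have [r0 _ _ _] := rep0.
have t11 : t1 + r < 1 by lra.
have rec := code_rec r0 t00 t01 t11.
have itv := code_itv r0 t00 t01 t11.
have repd (y : R) : replica r (if leading_bit y then t1 else t0) by case: leading_bit.
have appS k y : S (code_approx r t0 t1 k y).
  elim: k y => [|k IH] y /=; first exact: attractor0.
  have [_ _ _ Sd] := repd y; apply/Sd => //.
  exact: code_approx_itv.
have Scode y : S (code r t0 t1 y).
  apply: (closed_cvg _ _ _ _ (code_approx_cvg r0 t00 t01 t11 (y := y))).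
    exact: attractor_closed.
  by near=> k; exact: appS.
have wit k y : 0 <= y < 1 -> let g := code r t0 t1 y in
    exists z1 z2 z3 z4, [/\ S z1, ~ S z2, S z3, ~ S z4 &
      [/\ 0 <= z1 <= 1, 0 <= z2 <= 1, 0 <= z3 <= 1, 0 <= z4 <= 1 &
       [/\ g - r ^+ k < z1 < g, g - r ^+ k < z2 < g,
           g < z3 < g + r ^+ k & g < z4 < g + r ^+ k]]].
  elim: k y => [|k IH] y y01 /=.
    have [g0 gw] : t0 <= code r t0 t1 y /\ code r t0 t1 y < w.
      rewrite rec; have /andP[c0 c1] := itv (drop_leading_bit y).
      have h1 : 0 <= r * code r t0 t1 (drop_leading_bit y) by rewrite mulr_ge0 // ltW.
      have h2 : r * code r t0 t1 (drop_leading_bit y) <= r by rewrite ler_piMr // ltW.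
      by case: leading_bit; split; lra.
    have [k hk] := exists_expr_lt base_inv_itv t00.
    have Nk0 : 0 < N^-1 ^+ k by rewrite exprn_gt0 ?invr_gt0 ?base_gt0.
    have [_ _ _ Sk] := replica_origin k.
    have wk0 : 0 < N^-1 ^+ k * w by rewrite mulr_gt0 //; lra.
    have wk1 : N^-1 ^+ k * w <= N^-1 ^+ k by rewrite ler_piMr // ltW.
    exists (N^-1 ^+ k), (N^-1 ^+ k * w), 1, w; rewrite expr0.
    split => //.
    - by rewrite -[_ ^+ k]mul1r; apply: contract_origin; exact: attractor1.
    - by rewrite -[_ * w]addr0 Sk //; apply/andP; split; lra.
    - exact: attractor1.
    - by split; [..|split]; apply/andP; split; lra.
  have [z1 [z2 [z3 [z4 [Sz1 Nz2 Sz3 Nz4 [i1 i2 i3 i4 [b1 b2 b3 b4]]]]]]] :=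
    IH _ (drop_leading_bit_itv y01).
  have [_ td0 td1 Sd] := repd y.
  pose f z := r * z + (if leading_bit y then t1 else t0).
  have fitv z : 0 <= z <= 1 -> 0 <= f z <= 1.
    move=> /andP[h0 h1]; apply/andP; split; rewrite /f.
      by rewrite addr_ge0 // mulr_ge0 // ltW.
    by apply: le_trans td1; rewrite addrC lerD2l ler_piMr // ltW.
  have below g z : g - r ^+ k < z < g -> f g - r ^+ k.+1 < f z < f g.
    rewrite /f exprS => /andP[h1 h2].
    by rewrite ltrD2r ltr_pM2l // h2 andbT addrAC ltrD2r -mulrBr ltr_pM2l.
  have above g z : g < z < g + r ^+ k -> f g < f z < f g + r ^+ k.+1.
    rewrite /f exprS => /andP[h1 h2].
    by rewrite ltrD2r ltr_pM2l // h1 /= addrAC ltrD2r -mulrDr ltr_pM2l.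
  exists (f z1), (f z2), (f z3), (f z4); rewrite rec -/(f _).
  split; rewrite /f ?Sd // -/(f _).
  by split; [exact: fitv..|split; [exact: below|exact: below|exact: above|exact: above]].
move=> y y01; split => // e e0.
have [|k hk] := @exists_expr_lt _ r e _ e0; first by apply/andP; split; lra.
have [z1 [z2 [z3 [z4 [Sz1 Nz2 Sz3 Nz4 [_ _ _ _ [b1 b2 b3 b4]]]]]]] := wit k y y01.
split; [exists z1|exists z3|exists z2|exists z4]; split => //=; rewrite in_itv/=; lra.
Unshelve. all: by end_near. Qed.

(** A replica of positive offset, shrunk into [0, w], and the replica of the same
    ratio at the origin generate a self-similar set. The compositions of both with
    the former have disjoint images inside ]0, w[, so the two-sidedness of
    [code_points_in] and the separation of [code_expansion] hold. *)
Lemma hausdorff_dim_points_in_gt0 w : 0 < w < 1 -> ~ S w ->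
  (0 < hausdorff_dim (points_in S))%E.
Proof.
move=> w01 NSw; have [k [j [/andP[j0 jk] lj lj1]]] := gap_isolated_level w01 NSw.
have /andP[w0 w1] := w01.
have repj := replica_level jk lj (or_intror lj1).
have [l hl] := exists_expr_lt base_inv_itv w0.
have N0 : 0 < N^-1 by rewrite invr_gt0 base_gt0.
pose r := N^-1 ^+ l * N^-1 ^+ k; pose t := N^-1 ^+ l * (j%:R * N^-1 ^+ k) + 0.
have rept : replica r t := replica_comp (replica_origin l) repj.
have rep0 : replica r 0 by rewrite /r -exprD; exact: replica_origin.
have [r0 _ _ _] := rept.
have tE : t = j%:R * r by rewrite /t /r addr0; ring.
have rt : r <= t by rewrite tE ler_peMl ?ler1n // ltW.
have trw : t + r < w.
  have [_ _ jk1 _] := repj; apply: le_lt_trans hl.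
  rewrite /t /r addr0 -mulrDr ger_pMr ?exprn_gt0 //.
have t0 : 0 < t by lra.
have r1 : r < 1 by lra.
have rr : r * r < r by rewrite gtr_pMl.
have rt0 : 0 < r * t by rewrite mulr_gt0.
have rtr : r * t + r * r < r by rewrite -mulrDr gtr_pMr //; lra.
have rep00 := replica_comp rep0 rept; rewrite addr0 in rep00.
have rep11 := replica_comp rept rept.
apply: (@hausdorff_dim_two_maps_gt0 _ _ (r * r) (r * t) (r * t + t)); try lra.
- exact: mulr_gt0.
- by apply: (code_points_in rep00 rep11 (w := w)) => //; lra.
Qed.

(** The maximal gap around [w] has its end points in [S], and its scaled copies
    accumulating at 0 have this property too. *)
Lemma maximal_gaps_infinite w : 0 < w < 1 -> ~ S w -> infinite_set (maximal_gaps S).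
Proof.
move=> /andP[w0 w1] NSw; have N0 := base_gt0.
have [a [Sa /andP[a0 aw] aN]] :=
  closed_last_before attractor_closed attractor0 (ltW w0) NSw.
have [b [Sb /andP[wb b1] bN]] :=
  closed_first_after attractor_closed attractor1 (ltW w1) NSw.
pose r := N^-1; have /andP[_ r1] : 0 <= r < 1 := base_inv_itv.
have r0 : 0 < r by rewrite invr_gt0.
have rk0 k : 0 < r ^+ k by rewrite exprn_gt0.
have gap x : a < x < b -> ~ S x.
  move=> /andP[ax xb]; have [xw|wx] := leP x w.
    by apply: aN; rewrite ax.
  by apply: bN; rewrite xb ltW.
have rS k : r ^+ k.+1 < r ^+ k by rewrite exprS gtr_pMl.
apply: (@infinite_decreasing_family _ _ (fun k => b * r ^+ k)
          (fun k => `]a * r ^+ k, b * r ^+ k[%classic)) => [k|k|k x|k].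
- by rewrite ler_wpM2l ?ltW //; lra.
- apply: maximal_gap_of_endpoints.
  + by rewrite ltr_pM2r //; lra.
  + exact: contract_origin.
  + exact: contract_origin.
  + move=> x /andP[ax xb]; have [_ _ _ Sk] := replica_origin k.
    have xE : x = r ^+ k * (x / r ^+ k) + 0 by rewrite addr0 mulrC divfK // gt_eqF.
    rewrite -ltr_pdivlMr // in ax; rewrite -ltr_pdivrMr // in xb.
    rewrite xE Sk; first by apply: gap; apply/andP.
    by apply/andP; split; lra.
- by rewrite /= in_itv/= => /andP[_ /ltW].
- have lt1 : a * r ^+ k < b * r ^+ k by rewrite ltr_pM2r //; lra.
  have lt2 : b * r ^+ k.+1 < b * r ^+ k by rewrite ltr_pM2l //; lra.
  exists ((Num.max (a * r ^+ k) (b * r ^+ k.+1) + b * r ^+ k) / 2);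
    rewrite /= ?in_itv/=;
    by case: (leP (a * r ^+ k) (b * r ^+ k.+1)) => h; try (apply/andP; split); lra.
Qed.

(** A copy of [[c, d]] close to 0 is enclosed between [w] and a scaled copy of [w],
    so its component is a maximal interval inside ]0, 1[, where membership in [S]
    is invariant under scaling; its scaled copies are therefore maximal too. *)
Lemma maximal_intervals_infinite w c d : 0 < w < 1 -> ~ S w ->
  c < d -> `[c, d] `<=` S -> infinite_set (maximal_intervals S).
Proof.
move=> /andP[w0 w1] NSw cd cdS; have N0 := base_gt0.
pose r := N^-1; have /andP[_ r1] : 0 <= r < 1 := base_inv_itv.
have r0 : 0 < r by rewrite invr_gt0.
have rk0 k : 0 < r ^+ k by rewrite exprn_gt0.
have rSk k x : 0 <= x <= 1 -> S (x * r ^+ k) <-> S x.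
  by have [_ _ _ Sk] := replica_origin k; move=> /Sk; rewrite addr0 mulrC.
(* The left half is discarded to have a positive left end point, as [c] may
   be 0. *)
pose m := (c + d) / 2.
have inS x : c <= x <= d -> S x by move=> h; apply: cdS; rewrite /= in_itv.
have /andP[c0 _] : 0 <= c <= 2 by apply: attractor_itv; apply: inS; rewrite lexx ltW.
have [l hl] : exists l, r ^+ l < w / d.
  by apply: exists_expr_lt; [exact: base_inv_itv|rewrite divr_gt0//; lra].
rewrite ltr_pdivlMr in hl; last by lra.
have ml : 0 < m * r ^+ l by rewrite mulr_gt0 // /m; lra.
have [k hk] := exists_expr_lt base_inv_itv ml.
have NSe : ~ S (w * r ^+ k) by rewrite rSk //; apply/andP; split; lra.
have mS x : m * r ^+ l <= x <= d * r ^+ l -> S x.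
  move=> /andP[mx xd].
  rewrite -ler_pdivrMr // in xd; rewrite -ler_pdivlMr // in mx.
  rewrite -[x](@divfK _ (r ^+ l)) ?gt_eqF //; apply: contract_origin; apply: inS.
  by apply/andP; split => //; apply: le_trans mx; rewrite /m; lra.
have md : m * r ^+ l < d * r ^+ l by rewrite ltr_pM2r // /m; lra.
have [||a [/andP[ea am] aS Na]] :=
  closed_interval_left_end attractor_closed _ NSe _ (c := m * r ^+ l).
- by apply: le_lt_trans hk; rewrite ler_piMl // ltW.
- by apply: mS; rewrite lexx ltW.
have [||b [/andP[db bw] bS Nb]] :=
  closed_interval_right_end attractor_closed _ NSw _ (d := d * r ^+ l).
- by rewrite mulrC.
- by apply: mS; rewrite lexx ltW.
have a0 : 0 < a by apply: le_lt_trans ea; rewrite mulr_ge0 // ltW.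
have abS x : a <= x <= b -> S x.
  move=> /andP[ax xb]; have [xm|mx] := leP x (m * r ^+ l).
    by apply: aS; rewrite /= in_itv/= ax.
  have [xd|dx] := leP x (d * r ^+ l); first by apply: mS; rewrite xd ltW.
  by apply: bS; rewrite /= in_itv/= xb ltW.
have rS i : r ^+ i.+1 < r ^+ i by rewrite exprS gtr_pMl.
apply: (@infinite_decreasing_family _ _ (fun i => b * r ^+ i)
          (fun i => `[a * r ^+ i, b * r ^+ i]%classic)) => [i|i|i x|i].
- by rewrite ler_wpM2l ?ltW //; lra.
- apply: maximal_interval_of_ends.
  + by rewrite ltr_pM2r //; lra.
  + move=> x; rewrite /= in_itv/= => /andP[ax xb].
    rewrite -ler_pdivlMr // in ax; rewrite -ler_pdivrMr // in xb.
    rewrite -[x](@divfK _ (r ^+ i)) ?gt_eqF //; apply: contract_origin.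
    by apply: abS; rewrite ax.
  + move=> x; rewrite -ltr_pdivrMr // => xa.
    have [|y] := Na (Num.max 0 (x / r ^+ i)); first by rewrite gt_max a0 xa.
    rewrite gt_max => /andP[/andP[y0 xy] ya] NSy; exists (y * r ^+ i).
      by rewrite -ltr_pdivrMr // xy ltr_pM2r.
    by rewrite rSk //; apply/andP; split; lra.
  + move=> x; rewrite -ltr_pdivlMr // => xb.
    have [|y] := Nb (Num.min 1 (x / r ^+ i)); first by rewrite lt_min xb andbT; lra.
    rewrite lt_min => /andP[yb /andP[y1 yx]] NSy; exists (y * r ^+ i).
      by rewrite ltr_pM2r // yb -ltr_pdivlMr.
    by rewrite rSk //; apply/andP; split; lra.
- by rewrite /= in_itv/= => /andP[_].
- exists (b * r ^+ i); last by rewrite ltr_pM2l //; lra.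
  by rewrite /= in_itv/= lexx andbT ler_pM2r //; lra.
Qed.

Lemma infinitely_fragmented_of_left_gap w c d : 0 < w < 1 -> ~ S w ->
  c < d -> `[c, d] `<=` S -> infinitely_fragmented S.
Proof.
move=> w01 NSw cd cdS; split.
- apply: eq_card_nat; first exact: countable_maximal_intervals.
  exact: maximal_intervals_infinite w01 NSw cd cdS.
- apply: eq_card_nat; first exact: countable_maximal_gaps.
  exact: maximal_gaps_infinite w01 NSw.
- exact: hausdorff_dim_points_in_gt0 w01 NSw.
Qed.

(** No point is isolated: a point of a small copy of [S] differs from at least
    one of the images of 0 and 2 in that copy. *)
Lemma cantor_set_of_no_interval :
  (forall c d, c < d -> ~ `[c, d] `<=` S) -> cantor_set S.
Proof.
move=> noI; split.
  move=> x Sx; split; first exact: subset_closure.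
  move=> B /nbhs_ballP[e /= e0 eB].
  have := noI (x - e / 2) (x + e / 2); rewrite ltrD2l => h.
  apply: contrapT => nB; apply: h; first by lra.
  move=> y /=; rewrite in_itv/= => yI; apply: contrapT => NSy; apply: nB.
  exists y; split => //; apply: eB; rewrite /ball/= ltr_norml; lra.
apply/seteqP; split => // x [/set_mem Sx [B /nbhs_ballP[e /= e0 eB] BS]].
have N0 := base_gt0.
have e2 : 0 < e / 2 by lra.
have [k hk] := exists_expr_lt base_inv_itv e2.
have [s Ss [w lw xE]] := (attractor_level k x).1 Sx.
have Nk0 : 0 < N^-1 ^+ k by rewrite exprn_gt0 ?invr_gt0.
have /andP[s0 s2] := attractor_itv Ss.
have isx z : S z -> (z + w%:R) * N^-1 ^+ k = x.
  move=> Sz; have /andP[z0 z2] := attractor_itv Sz.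
  suff : [set x] ((z + w%:R) * N^-1 ^+ k) by [].
  rewrite -BS; split; last first.
    by apply/(attractor_level k); exists z => //; exists w; rewrite ?exprVn.
  apply: eB; rewrite /ball/= xE -exprVn -mulrBl opprD addrACA subrr addr0.
  rewrite normrM (gtr0_norm Nk0).
  apply: (@le_lt_trans _ _ (2 * N^-1 ^+ k)); last by lra.
  by rewrite ler_pM2r // ler_norml; lra.
have := isx _ attractor0; rewrite -(isx _ attractor2) => /(mulIf (lt0r_neq0 Nk0)).
by move/addIr => h; lra.
Qed.

End DigitAttractor.

(** * The trichotomy *)

Section Trichotomy.
Local Set Implicit Arguments.
Local Unset Strict Implicit.
Variables (R : realType) (n : nat).
Hypothesis n_ge2 : (2 <= n)%N.

Lemma spanning_digits_reflect (D : set nat) : spanning_digits n D ->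
  spanning_digits n [set (n.-1 + n.-1 - d)%N | d in D].
Proof.
move=> [Dle D0 D1 D2]; split.
- by move=> _ [d _ <-] /=; rewrite leq_subr.
- by exists (n.-1 + n.-1)%N; rewrite // subnn.
- by exists n.-1; rewrite // addnK.
- by exists 0%N; rewrite // subn0.
Qed.

Lemma attractor_reflect (D : set nat) (S : set R) : spanning_digits n D ->
  is_attractor (@digit_ifs R n D) S ->
  is_attractor (@digit_ifs R n [set (n.-1 + n.-1 - d)%N | d in D]) (reflect_set 2 S).
Proof.
move=> DP attrS; have [S0 cS _] := attrS; have [Dle _ _ _] := DP.
have step := attractor_step attrS.
have digit s d : D d -> 2 - (s + d%:R) / n%:R =
    (2 - s + (n.-1 + n.-1 - d)%:R) / n%:R :> R.
  move=> /Dle dle; rewrite natrB // natrD base_predE //; field.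
  by rewrite pnatr_eq0; case: n n_ge2.
split.
- by case: S0 => s Ss; exists (2 - s); exists s.
- apply: continuous_compact => //; apply: continuous_subspaceT => x.
  by apply: cvgB; [exact: cvg_cst|exact: cvg_id].
- apply/seteqP; split.
    move=> _ [x /step[s Ss [d Dd ->]] <-]; rewrite (digit _ _ Dd).
    exists (fun x : R => (x + (n.-1 + n.-1 - d)%:R) / n%:R).
      by exists (n.-1 + n.-1 - d)%N => //; exists d.
    by exists (2 - s) => //; exists s.
  move=> _ [_ [_ [d Dd <-] <-] [_ [s Ss <-] <-]]; rewrite -digit //.
  by exists ((s + d%:R) / n%:R) => //; apply/step; exists s => //; exists d.
Qed.

(** A gap of [S] in [0, 2] avoids 1, which is in [S]; it lies in the left or the
    right half, and the reflection [x |-> 2 - x] reduces the latter case to the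
    former. *)
Lemma digit_attractor_trichotomy (D : set nat) (S : set R) : spanning_digits n D ->
  is_attractor (@digit_ifs R n D) S ->
  [\/ S = `[0, 2]%classic, cantor_set S | infinitely_fragmented S].
Proof.
move=> DP attrS.
have [[c [d [cd cdS]]]|noI] := pselect (exists c d, c < d /\ `[c, d] `<=` S); last first.
  constructor 2; apply: (cantor_set_of_no_interval n_ge2 DP attrS) => c d cd cdS.
  by apply: noI; exists c, d.
have [full|nfull] := pselect (`[0, 2] `<=` S).
  constructor 1; apply/seteqP; split => // x Sx.
  by rewrite /= in_itv; exact: (attractor_itv n_ge2 DP attrS).
constructor 3.
have [w /not_implyP[/=]] := (existsNP _).2 nfull.
rewrite in_itv/= => /andP[w0 w2] NSw.
have S0 := attractor0 n_ge2 DP attrS; have S1 := attractor1 n_ge2 DP attrS.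
have S2 := attractor2 n_ge2 DP attrS.
have neq x : S x -> w != x by move=> Sx; apply/eqP => h; apply: NSw; rewrite h.
have [w1|w1] := leP w 1.
  apply: (infinitely_fragmented_of_left_gap n_ge2 DP attrS _ NSw cd cdS).
  by rewrite !lt_neqAle w0 w1 !andbT eq_sym !neq.
apply: (@infinitely_fragmented_reflect R 2).
apply: (infinitely_fragmented_of_left_gap n_ge2 (spanning_digits_reflect DP)
  (attractor_reflect DP attrS) (w := 2 - w) (c := 2 - d) (d := 2 - c)).
- by rewrite subr_gt0 lt_neqAle w2 neq //=; lra.
- by rewrite reflect_setP subKr.
- by lra.
- move=> x; rewrite /= in_itv/= => xI; apply/reflect_setP; apply: cdS.
  by rewrite /= in_itv/=; lra.
Qed.

Lemma attractor_minkowski_sum (A : set nat) (C : set R) :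
  is_attractor (@digit_ifs R n A) C ->
  is_attractor (@digit_ifs R n [set (a + a')%N | a in A & a' in A]) (minkowski_sum C C).
Proof.
move=> attrC; have [[c0 Cc0] cC _] := attrC; have step := attractor_step attrC.
split.
- by exists (c0 + c0); exists c0 => //; exists c0.
- have -> : minkowski_sum C C = (fun x : R * R => x.1 + x.2) @` (C `*` C).
    apply/seteqP; split.
      by move=> _ [x Cx [y Cy <-]]; exists (x, y).
    by move=> _ [[x y] [/= Cx Cy] <-]; exists x => //; exists y.
  apply: continuous_compact; last exact: compact_setX.
  by apply: continuous_subspaceT => x; exact: add_continuous.
- have sumE (x y : R) (a b : nat) :
      (x + a%:R) / n%:R + (y + b%:R) / n%:R = (x + y + (a + b)%:R) / n%:R.
    by rewrite natrD; ring.
  apply/seteqP; split.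
    move=> _ [_ /step[x Cx [a Aa ->]] [_ /step[y Cy [b Ab ->]] <-]].
    exists (fun x : R => (x + (a + b)%:R) / n%:R).
      by exists (a + b)%N => //; exists a => //; exists b.
    by exists (x + y); [exists x => //; exists y|rewrite sumE].
  move=> _ [_ [_ [a Aa [b Ab <-]] <-] [_ [x Cx [y Cy <-]] <-]].
  rewrite -sumE; exists ((x + a%:R) / n%:R).
    by apply/step; exists x => //; exists a.
  by exists ((y + b%:R) / n%:R) => //; apply/step; exists y => //; exists b.
Qed.

End Trichotomy.

Theorem theorem5p2 (R : realType) (n : nat) (A : set nat) (C : set R)
    (hn : (2 <= n)%N)
    (hA : A `<=` `I_n) (hA0 : A 0%N) (hAn : A n.-1)
    (hC : is_attractor (@digit_ifs R n A) C) :
  let S := minkowski_sum C C in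
  [\/ S = `[0, 2]%classic,
      cantor_set S
    | [/\ (maximal_intervals S #= [set: nat])%card,
          (maximal_gaps S #= [set: nat])%card
        & (0 < hausdorff_dim (points_in S))%E]].
Proof.
apply: (digit_attractor_trichotomy hn _ (attractor_minkowski_sum hC)).
have le a : A a -> (a <= n.-1)%N by move=> /hA an; rewrite -ltnS prednK // ltnW.
split.
- by move=> _ [a /le ha [b /le hb <-]]; exact: leq_add.
- by exists 0%N => //; exists 0%N.
- by exists 0%N => //; exists n.-1.
- by exists n.-1 => //; exists n.-1.
Qed.
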